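(* Every bipartitioned circular interval graph satisfies Frankl's conjecture: if $G$ is a bipartitioned circular interval graph with bipartition classes $U,W$ (the two classes of the partition used to construct it) and $G$ has at least one edge, then each of $U$ and $W$ contains a vertex belonging to at most half of the maximal stable sets of $G$.
   Context: A circular interval graph is defined by a finite subset $V$ of a circle (the vertex set) and a set $\mathcal I$ of subintervals (arcs) of the circle; two vertices are adjacent if some interval of $\mathcal I$ contains both. A bipartitioned circular interval graph is obtained from a circular interval graph by partitioning its vertex set into two classes $U,W$ and deleting every edge with both endvertices in the same class. A set of vertices is stable if no two are adjacent; maximal means maximal under inclusion. (Edgeless graphs are considered to satisfy Frankl's conjecture trivially.) *)

(* Defs.v *)
From mathcomp Require Import all_boot all_order all_algebra finmap.
From mathcomp Require Import all_classical all_reals all_analysis.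

Set Implicit Arguments.
Unset Strict Implicit.
Unset Printing Implicit Defensive.

Import Order.TTheory GRing.Theory Num.Theory.

Local Open Scope classical_set_scope.
Local Open Scope ring_scope.

Section StableSets.
Variables (T : finType) (e : rel T).

Definition stable_set (S : {set T}) : bool :=
  [forall x in S, forall y in S, ~~ e x y].

Definition max_stable_sets : {set {set T}} :=
  [set S : {set T} | maxset stable_set S]%SET.

Definition in_at_most_half (x : T) : Prop :=
  (2 * #|[set S in max_stable_sets | x \in S]%SET| <= #|max_stable_sets|)%N.

End StableSets.

Section CircularIntervalGraphs.
Variable R : realType.

Definition circle : set (R * R) := [set p | p.1 ^+ 2 + p.2 ^+ 2 = 1].

(* The images of the intervals of the real line under the covering map; the
   interval may be open, closed or half-open, and a long one may wrap around
   and cover the whole circle. *)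
Definition circle_arc (A : set (R * R)) : Prop :=
  exists2 J : set R, is_interval J & A = [set (cos t, sin t) | t in J].

Definition circular_interval_adj (V : {fset R * R}) (I : set (set (R * R))) :
    rel V :=
  fun x y => (x != y) && `[< exists2 A, I A & A (val x) /\ A (val y) >].

End CircularIntervalGraphs.

Definition del_class_edges (T : finType) (U W : {set T}) (e : rel T) : rel T :=
  fun x y => [&& e x y, ~~ ((x \in U) && (y \in U))
                      & ~~ ((x \in W) && (y \in W))].

Definition bipartitioned_circular_interval_adj (R : realType)
    (V : {fset R * R}) (I : set (set (R * R))) (U W : {set V}) : rel V :=
  del_class_edges U W (circular_interval_adj I).

(* Main.v *)
(** Let x be a vertex of a bipartite graph and A a set of neighbours of x such
that every vertex adjacent to a neighbour of x is adjacent to some vertex of A.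
A maximal stable set containing A contains all of N(x), so deleting N(x) (and
completing on the side of x) injects the maximal stable sets containing A into
those avoiding A.  If A = {y, z}, it follows that y or z lies in at most half of
the maximal stable sets.

To find such y, z in a prescribed class, take x non-isolated in the other class
with a non-neighbour p in the prescribed class.  No arc through x contains p, so
after cutting the circle at p the first and the last neighbour of x serve as y
and z: an arc joining u to a neighbour of x contains y or z unless u lies
between them, and then an arc joining x to y or to z contains u.  If there is no
such pair x, p, then each non-isolated vertex of the other class is adjacent to
the whole prescribed class, and y = z can be any non-isolated vertex of the
latter. *)

Require Import Defs.
From mathcomp Require Import all_boot all_order all_algebra finmap.
From mathcomp Require Import all_classical all_reals all_analysis.
From mathcomp Require Import zify lra.

Set Implicit Arguments.
Unset Strict Implicit.
Unset Printing Implicit Defensive.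

Import Order.TTheory GRing.Theory Num.Theory.

Section MaximalStableSets.
Variables (T : finType) (e : rel T).
Hypotheses (e_sym : symmetric e) (e_irr : irreflexive e).

Lemma stable_setP (S : {set T}) :
  reflect {in S &, forall u v, ~~ e u v} (stable_set e S).
Proof.
apply: (iffP forall_inP) => [S_st u v uS vS|S_st u uS].
  exact: (forall_inP (S_st u uS)).
by apply/forall_inP => v; exact: S_st.
Qed.

Lemma max_stable_setsP (S : {set T}) :
  reflect ({in S &, forall u v, ~~ e u v} /\
           forall v, v \notin S -> exists2 u, u \in S & e u v)
          (S \in max_stable_sets e).
Proof.
rewrite inE; apply: (iffP maxsetP) => [[/stable_setP S_st S_max]|[S_st S_dom]].
  split=> // v vS; apply/exists_inP; apply: contraT => /exists_inPn v_nadj.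
  have vS_st : stable_set e (v |: S).
    apply/stable_setP => a b /setU1P[->|aS] /setU1P[->|bS].
    - by rewrite e_irr.
    - by rewrite e_sym v_nadj.
    - exact: v_nadj.
    - exact: S_st.
  by move: vS; rewrite -(S_max _ vS_st (finset.subsetUr _ _)) setU11.
split=> [|B /stable_setP B_st SB]; first exact/stable_setP.
apply/eqP; rewrite finset.eqEsubset SB andbT; apply/fintype.subsetP => v vB.
apply: contraT => /S_dom[u uS uv].
by have := B_st u v (fintype.subsetP SB u uS) vB; rewrite uv.
Qed.

End MaximalStableSets.

Definition neighbours (T : finType) (e : rel T) (x : T) : {set T} :=
  [set y | e x y].

Definition dominates_second_neighbours (T : finType) (e : rel T) (x : T)
    (A : {set T}) : Prop :=
  forall v u, e x v -> e v u -> exists2 w, w \in A & e u w.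

Definition is_bipartition (T : finType) (e : rel T) (U : {set T}) : Prop :=
  forall u v, e u v -> (u \in U) = (v \notin U).

Section BipartiteGraphs.
Variables (T : finType) (e : rel T) (U : {set T}).
Hypotheses (e_sym : symmetric e) (e_bip : is_bipartition e U).

Local Notation M := (max_stable_sets e).

Lemma bipartite_irreflexive : irreflexive e.
Proof. by move=> u; apply/negP => /e_bip; case: (u \in U). Qed.

Let maxP := max_stable_setsP e_sym bipartite_irreflexive.

Lemma bipartition_adj_in u v : e u v -> u \in U -> v \notin U.
Proof. by move=> /e_bip ->. Qed.

Lemma bipartition_adj_out u v : e u v -> u \notin U -> v \in U.
Proof. by move=> /e_bip ->; rewrite negbK. Qed.

Definition completion (B : {set T}) : {set T} :=
  B :|: [set u | (u \notin U) && [forall w in B, ~~ e u w]].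

Lemma mem_completion_in B v : v \in U -> (v \in completion B) = (v \in B).
Proof. by move=> vU; rewrite !inE vU orbF. Qed.

Lemma mem_completion_out (B : {set T}) v : B \subset U -> v \notin U ->
  (v \in completion B) = [forall w in B, ~~ e v w].
Proof.
by move=> /fintype.subsetP BU vU; rewrite !inE vU (contraNF (BU v)).
Qed.

Lemma completion_trace S : S \in M -> completion (S :&: U) = S.
Proof.
move=> /maxP[S_st S_dom]; apply/setP => v.
have [vU|vU] := boolP (v \in U).
  by rewrite mem_completion_in // finset.in_setI vU andbT.
rewrite mem_completion_out ?finset.subsetIr //.
apply/forall_inP/idP => [v_nadj|vS w].
  apply: contraT => /S_dom[w wS wv]; have wU : w \in U by rewrite (e_bip wv).
  by have := v_nadj w; rewrite inE wS wU e_sym wv => /(_ isT).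
by rewrite inE => /andP[wS _]; exact: S_st.
Qed.

Lemma completion_max (B : {set T}) : B \subset U ->
  (forall v, v \in U -> v \notin B ->
     exists2 u, e u v & {in B, forall w, ~~ e u w}) ->
  completion B \in M.
Proof.
move=> BU B_closed; apply/maxP; split=> [u v uC vC|v].
  wlog uU : u v uC vC / u \in U => [wl|].
    have [uU|uU] := boolP (u \in U); first exact: wl.
    have [vU|vU] := boolP (v \in U); first by rewrite e_sym wl.
    by apply/negP => /e_bip; rewrite (negbTE uU) vU.
  apply/negP => uv; move: vC.
  rewrite mem_completion_out // -?(e_bip uv) // => /forall_inP/(_ u).
  by rewrite -(mem_completion_in _ uU) uC e_sym uv => /(_ isT).
have [vU|vU] := boolP (v \in U).
  rewrite mem_completion_in // => /(B_closed _ vU)[u uv u_nadj]; exists u => //.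
  by rewrite mem_completion_out ?(e_bip uv) ?negbK //; exact/forall_inP.
rewrite mem_completion_out // => /forall_inPn[w wB /negPn vw].
exists w; last by rewrite e_sym.
by rewrite mem_completion_in // (fintype.subsetP BU).
Qed.

Section DropNeighbours.
Variable x : T.
Hypothesis xU : x \notin U.

Definition drop_neighbours (S : {set T}) : {set T} :=
  completion ((S :&: U) :\: neighbours e x).

Lemma drop_neighbours_max S : S \in M -> drop_neighbours S \in M.
Proof.
move=> /maxP[S_st S_dom]; apply: completion_max.
  by rewrite finset.subDset finset.setUC finset.subsetU // finset.subsetIr.
move=> v vU; rewrite !inE vU andbT negb_and negbK => /orP[xv|/S_dom[u uS uv]].
  by exists x => // w; rewrite !inE => /andP[].
by exists u => // w; rewrite !inE => /and3P[_ wS _]; exact: S_st.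
Qed.

Lemma drop_neighbours_disjoint (A S : {set T}) :
  A \subset neighbours e x -> [disjoint A & drop_neighbours S].
Proof.
move=> /fintype.subsetP AN; apply/pred0P => w /=; apply/negP => /andP[/AN].
rewrite inE => xw; have wU := bipartition_adj_out xw xU.
by rewrite mem_completion_in // !inE xw.
Qed.

Lemma drop_neighbours_inj :
  {in [pred S | S \in M & neighbours e x \subset S] &,
     injective drop_neighbours}.
Proof.
move=> S1 S2 /andP[/= S1M N1] /andP[/= S2M N2] eq_drop.
rewrite -(completion_trace S1M) -(completion_trace S2M); congr completion.
apply/setP => w; rewrite !finset.in_setI.
have [wU|] := boolP (w \in U); rewrite ?andbF // !andbT.
have [wN|wN] := boolP (w \in neighbours e x).
  by rewrite !(fintype.subsetP _ _ wN).
have := mem_completion_in (S1 :&: U :\: neighbours e x) wU.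
rewrite -/(drop_neighbours S1) eq_drop mem_completion_in //.
by rewrite !finset.in_setD !finset.in_setI wN wU !andbT.
Qed.

Lemma neighbours_sub_max_stable (A S : {set T}) :
  dominates_second_neighbours e x A -> S \in M -> A \subset S ->
  neighbours e x \subset S.
Proof.
move=> A_dom /maxP[S_st S_dom] /fintype.subsetP AS.
apply/fintype.subsetP => v; rewrite inE => xv; apply: contraT => /S_dom[u uS].
rewrite e_sym => /(A_dom _ _ xv)[w /AS wS uw].
by have := S_st u w uS wS; rewrite uw.
Qed.

Lemma leq_card_max_stable_sup_disjoint (A : {set T}) :
  A \subset neighbours e x -> dominates_second_neighbours e x A ->
  #|[set S in M | A \subset S]| <= #|[set S in M | [disjoint A & S]]|.
Proof.
move=> AN A_dom; rewrite -(@card_in_imset _ _ drop_neighbours).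
  apply/subset_leq_card/fintype.subsetP => _ /imsetP[S /setIdP[SM _] ->].
  by apply/setIdP; rewrite drop_neighbours_max ?drop_neighbours_disjoint.
apply: sub_in2 drop_neighbours_inj => S /setIdP[SM AS].
by rewrite inE /= SM (neighbours_sub_max_stable A_dom).
Qed.

End DropNeighbours.

End BipartiteGraphs.

Lemma leq_card_half_or (T : finType) (M A B : {set T}) :
  A \subset M -> B \subset M -> #|A :&: B| <= #|M :\: (A :|: B)| ->
  2 * #|A| <= #|M| \/ 2 * #|B| <= #|M|.
Proof.
move=> AM BM; have := cardsUI A B; have := cardsID (A :|: B) M.
rewrite (finset.setIidPr _) ?finset.subUset ?AM // => <-; lia.
Qed.

Lemma in_at_most_half_dominating_pair (T : finType) (e : rel T) (U : {set T})
    (x y z : T) :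
  symmetric e -> is_bipartition e U -> x \notin U -> e x y -> e x z ->
  dominates_second_neighbours e x [set y; z] ->
  in_at_most_half e y \/ in_at_most_half e z.
Proof.
move=> e_sym e_bip xU xy xz yz_dom.
set M := max_stable_sets e; pose having w := [set S in M | w \in S].
have having_M w : having w \subset M.
  by apply/fintype.subsetP => S /setIdP[].
have having_both :
    having y :&: having z \subset [set S in M | [set y; z] \subset S].
  apply/fintype.subsetP => S /setIP[/setIdP[SM yS] /setIdP[_ zS]].
  by apply/setIdP; rewrite finset.subUset !finset.sub1set yS.
have having_neither : [set S in M | [disjoint [set y; z] & S]]
    \subset M :\: (having y :|: having z).
  apply/fintype.subsetP => S /setIdP[SM yz_S]; apply/setDP; split=> //.
  by apply/setUP; case=> /setIdP[_]; rewrite (disjointFr yz_S) ?set21 ?set22.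
have yz_nbrs : [set y; z] \subset neighbours e x.
  by apply/fintype.subsetP => w /set2P[] ->; rewrite inE.
apply: (leq_card_half_or (having_M y) (having_M z)).
apply: leq_trans (subset_leq_card having_both) _.
apply: leq_trans (subset_leq_card having_neither).
exact: (leq_card_max_stable_sup_disjoint e_sym e_bip xU yz_nbrs yz_dom).
Qed.

Section CircularOrder.
Context {d : Order.disp_t} {L : orderType d}.
Implicit Types s t r : L.
Local Open Scope order_scope.
Local Open Scope classical_set_scope.

(* Going up from [s] to [t], through the cut when [t < s]. *)
Definition circular_itv s t : set L :=
  [set r | if s <= t then s <= r <= t else (s <= r) || (r <= t)].

Lemma circular_itv_outside y z u v : y <= v <= z -> u < y \/ z < u ->
  circular_itv u v y /\ circular_itv v u z.
Proof.
move=> /andP[yv vz] [uy|zu]; rewrite /circular_itv /=.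
  have uv := lt_le_trans uy yv.
  by rewrite (ltW uv) (ltW uy) yv leNgt uv vz.
have vu := le_lt_trans vz zu.
by rewrite (ltW vu) vz (ltW zu) leNgt vu yv orbT.
Qed.

Section Convexity.
Variables (T : Type) (D : set T) (theta : T -> L).
Implicit Types (A : set T) (F : set (set T)).

Definition circularly_convex A : Prop := forall u v, A u -> A v ->
  D `&` theta @^-1` circular_itv (theta u) (theta v) `<=` A \/
  D `&` theta @^-1` circular_itv (theta v) (theta u) `<=` A.

Definition linearly_convex A : Prop := forall u v, A u -> A v ->
  D `&` [set q | theta u <= theta q <= theta v] `<=` A.

Lemma circularly_convex_cut p A : circularly_convex A ->
  D p -> (forall q, theta p <= theta q) -> ~ A p -> linearly_convex A.
Proof.
move=> A_conv Dp p_min Ap u v Au Av q [Dq /andP[uq qv]].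
have uv := le_trans uq qv.
have [uv_A|vu_A] := A_conv _ _ Au Av.
  by apply: uv_A; rewrite /circular_itv /= uv uq.
have [vu|uv_lt] := leP (theta v) (theta u); last first.
  by case: Ap; apply: vu_A; rewrite /circular_itv /= leNgt uv_lt p_min orbT.
apply: vu_A; rewrite /circular_itv /= vu.
by rewrite (le_trans vu uq) (le_trans qv vu).
Qed.

Definition in_common_member F u v : Prop := exists2 A, F A & A u /\ A v.

Lemma in_common_member_sym F u v :
  in_common_member F u v -> in_common_member F v u.
Proof. by move=> [A FA [Au Av]]; exists A. Qed.

Lemma in_common_member_extremes F x y z u v :
  D y -> D z -> D u ->
  (forall A, F A -> circularly_convex A) ->
  (forall A, F A -> A x -> linearly_convex A) ->
  in_common_member F x y -> in_common_member F x z ->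
  theta y <= theta v <= theta z -> in_common_member F v u ->
  in_common_member F u y \/ in_common_member F u z.
Proof.
move=> Dy Dz Du F_circ Fx_lin [B FB [Bx By]] [C FC [Cx Cz]] yvz.
move=> [A FA [Av Au]].
have [/andP[yu uz]|u_out] := boolP (theta y <= theta u <= theta z).
  have [ux|/ltW xu] := leP (theta u) (theta x).
    left; exists B => //; split=> //.
    by apply: (Fx_lin _ FB Bx _ _ By Bx); rewrite /= yu ux.
  right; exists C => //; split=> //.
  by apply: (Fx_lin _ FC Cx _ _ Cx Cz); rewrite /= xu uz.
have [uv_y vu_z] : circular_itv (theta u) (theta v) (theta y) /\
                   circular_itv (theta v) (theta u) (theta z).
  apply: circular_itv_outside yvz _; apply/orP.
  by move: u_out; rewrite negb_and -!ltNge.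
by have [uv_A|vu_A] := F_circ _ FA _ _ Au Av; [left|right]; exists A;
  do ?split; do ?[exact: uv_A|exact: vu_A].
Qed.

End Convexity.

End CircularOrder.

Local Open Scope ring_scope.

Lemma periodicz (U V : zmodType) (f : U -> V) (T : U) :
  periodic f T -> forall (k : int) a, f (a + T *~ k) = f a.
Proof.
move=> fT [n|n] a; first exact: periodicn.
by rewrite NegzE mulrNz -[LHS](periodicn fT n.+1) subrK.
Qed.

Section CircularIntervalLift.
Variable R : realDomainType.
Implicit Types (a c r s t : R) (k l m : int).

Lemma mulrz_le_or_gap c k l :
  0 < c -> c *~ k <= c *~ l \/ c *~ l + c <= c *~ k.
Proof.
move=> c0; rewrite -[X in _ + X]mulr1z -mulrzDr !ler_pMz2l // lezD1.
by have [] := leP k l; [left|right].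
Qed.

Lemma circular_itv_lift a c r s t k l :
  a <= r < a + c -> a <= s < a + c -> a <= t < a + c ->
  s + c *~ k <= t + c *~ l -> circular_itv s t r ->
  exists m, s + c *~ k <= r + c *~ m <= t + c *~ l.
Proof.
move=> r_itv s_itv t_itv st; have c0 : 0 < c by lra.
have k_l := mulrz_le_or_gap k l c0; have l_k := mulrz_le_or_gap l k c0.
rewrite /circular_itv /=; case: leP => [_ srt|ts /orP[sr|rt]].
- by exists k; case: k_l; lra.
- by exists k; case: l_k; lra.
- by exists l; case: l_k; lra.
Qed.

End CircularIntervalLift.

Section Angles.
Variable R : realType.
Implicit Types (a r s t : R) (k : int) (p q : R * R).

Let pi2_gt0 : 0 < pi *+ 2 :> R.
Proof. by rewrite mulrn_wgt0 // pi_gt0. Qed.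

Definition circle_point t : R * R := (cos t, sin t).

Lemma circle_pointDz t k : circle_point (t + (pi *+ 2) *~ k) = circle_point t.
Proof.
by rewrite /circle_point (periodicz (@cosD2pi R)) (periodicz (@sinD2pi R)).
Qed.

Lemma angle_reduction a t :
  exists k, a <= t + (pi *+ 2) *~ k < a + pi *+ 2.
Proof.
exists (- Num.floor ((t - a) / (pi *+ 2))).
have := floor_itv ((t - a) / (pi *+ 2)); set m := Num.floor _ => /andP[].
rewrite intrD1 ler_pdivlMr // ltr_pdivrMr // mulrDl mul1r mulrzl mulrNz; lra.
Qed.

Lemma cos_eq1 r : 0 <= r < pi *+ 2 -> cos r = 1 -> r = 0.
Proof.
have cos_eq1_pi u : 0 <= u <= pi -> cos u = 1 -> u = 0.
  by move=> u_itv cu; apply: cos_inj; rewrite ?cos0 // in_itv /= ?lexx ?pi_ge0.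
move=> /andP[r0 r2pi] cr; have [rle|rgt] := leP r pi.
  by apply: cos_eq1_pi; rewrite ?r0.
suff : pi *+ 2 - r = 0 by lra.
apply: cos_eq1_pi; first lra.
by rewrite cosB cos2pi sin2pi cr mul1r mul0r addr0.
Qed.

Lemma circle_point_cosB s t :
  circle_point s = circle_point t -> cos (s - t) = 1.
Proof.
by case=> cos_st sin_st; rewrite cosB cos_st sin_st -!expr2 cos2Dsin2.
Qed.

Lemma circle_point_inj s t : circle_point s = circle_point t ->
  exists k, s = t + (pi *+ 2) *~ k.
Proof.
move=> /circle_point_cosB cos_st; have [k r_itv] := angle_reduction 0 (s - t).
exists (- k); suff : s - t + (pi *+ 2) *~ k = 0 by rewrite mulrNz; lra.
apply: cos_eq1; first by move: r_itv; rewrite add0r.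
by rewrite (periodicz (@cosD2pi R)).
Qed.

Lemma circle_point_surj q : circle q -> exists t, circle_point t = q.
Proof.
case: q => x y /= xy1; have {}xy1 : x ^+ 2 + y ^+ 2 = 1 := xy1.
have x_itv : -1 <= x <= 1 by nra.
have cos_acos : cos (acos x) = x by apply: acosK; rewrite in_itv.
have sin_acos : sin (acos x) = `|y|.
  by rewrite sin_acos // (_ : 1 - x ^+ 2 = y ^+ 2) ?sqrtr_sqr //; lra.
have [y0|y0] := leP 0 y.
  by exists (acos x); rewrite /circle_point cos_acos sin_acos ger0_norm.
exists (- acos x); rewrite /circle_point cosN sinN cos_acos sin_acos.
by rewrite ltr0_norm // opprK.
Qed.

(* Off the circle [angle a] takes the junk value [a]. *)
Definition angle a q : R :=
  xget a [set t | a <= t < a + pi *+ 2 /\ circle_point t = q]%classic.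

Lemma angle_itv a q : a <= angle a q < a + pi *+ 2.
Proof. by rewrite /angle; case: xgetP => [t _ []//|_]; rewrite lexx ltrDl. Qed.

Lemma angleK a q : circle q -> circle_point (angle a q) = q.
Proof.
move=> /circle_point_surj[t <-]; have [k tk_itv] := angle_reduction a t.
by have [] : [set t' | _]%classic (angle a (circle_point t)) :=
  xgetPex a (ex_intro _ _ (conj tk_itv (circle_pointDz t k))).
Qed.

Lemma angle_cut a : angle a (circle_point a) = a.
Proof.
apply: xget_unique => [|t [/andP[at_ ta] /circle_point_cosB cos_ta]] /=.
  by rewrite lexx ltrDl pi2_gt0.
suff : t - a = 0 by lra.
by apply: cos_eq1 cos_ta; lra.
Qed.

Lemma angle_cut_min a p q :
  circle p -> angle (angle a p) p <= angle (angle a p) q.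
Proof.
move=> /(angleK a) pE; rewrite -{2}pE angle_cut.
by case/andP: (angle_itv (angle a p) q).
Qed.

Lemma circle_point_circular_itv a s t q : s <= t -> circle q ->
  circular_itv (angle a (circle_point s)) (angle a (circle_point t))
               (angle a q) ->
  exists2 r, s <= r <= t & circle_point r = q.
Proof.
have circle_circle_point r : circle (circle_point r) by exact: cos2Dsin2.
have [k sE] := circle_point_inj (esym (angleK a (circle_circle_point s))).
have [l tE] := circle_point_inj (esym (angleK a (circle_circle_point t))).
rewrite {1}sE {1}tE => st q_circle q_itv.
have [m] := circular_itv_lift (angle_itv a q) (angle_itv _ _) (angle_itv _ _)
  st q_itv.
rewrite -sE -tE; exists (angle a q + pi *+ 2 *~ m) => //.
by rewrite circle_pointDz angleK.
Qed.

Lemma circle_arc_circularly_convex a (A : set (R * R)) : circle_arc A ->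
  circularly_convex (@circle R) (angle a) A.
Proof.
move=> [J J_itv ->].
have lift s t : J s -> J t -> s <= t ->
    (@circle R `&` angle a @^-1`
      circular_itv (angle a (circle_point s)) (angle a (circle_point t))
     `<=` circle_point @` J)%classic.
  move=> Js Jt st q [q_circle q_itv].
  have [r srt <-] := circle_point_circular_itv st q_circle q_itv.
  by exists r => //; exact: J_itv srt.
move=> _ _ [s Js <-] [t Jt <-].
by have [st|/ltW ts] := leP s t; [left|right]; exact: lift.
Qed.

End Angles.

Section BipartitionedCircularIntervalGraphs.
Variables (R : realType) (V : {fset R * R}) (I : set (set (R * R))).
Variables U W : {set V}.
Hypothesis V_circle : forall p, p \in V -> circle p.
Hypothesis I_arcs : forall A, I A -> circle_arc A.
Hypothesis UW_cover : U :|: W = [set: V].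
Hypothesis UW_disjoint : [disjoint U & W].

Local Notation e := (bipartitioned_circular_interval_adj I U W).

Lemma mem_second_class v : (v \in W) = (v \notin U).
Proof.
have := finset.in_setT v; rewrite -UW_cover inE.
by have [/(disjointFr UW_disjoint)|] := boolP (v \in U).
Qed.

Lemma bipartitioned_adjP u v :
  reflect ((u \in U) = (v \notin U) /\ in_common_member I (val u) (val v))
          (e u v).
Proof.
rewrite /bipartitioned_circular_interval_adj /del_class_edges.
rewrite /circular_interval_adj !mem_second_class.
apply: (iffP and3P) => [[/andP[_ /asboolP]]|[uv I_uv]].
  by case: (u \in U); case: (v \in U).
have u_neq_v : u != v by apply: contra_eq_neq uv => ->; case: (v \in U).
rewrite u_neq_v uv; split; [exact/asboolP | by case: (v \in U)..].
Qed.

Lemma bipartitioned_adj_sym : symmetric e.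
Proof.
suff sub u v : e u v -> e v u by move=> u v; apply/idP/idP; exact: sub.
move=> /bipartitioned_adjP[uv I_uv]; apply/bipartitioned_adjP.
by split; [rewrite uv negbK | exact: in_common_member_sym].
Qed.

Lemma bipartitioned_adj_bipartition : is_bipartition e U.
Proof. by move=> u v /bipartitioned_adjP[]. Qed.

Let e_bip := bipartitioned_adj_bipartition.

Lemma in_circle (v : V) : circle (val v).
Proof. exact: V_circle (valP v). Qed.

Lemma nonadjacent_linearly_convex x p A :
  x \notin U -> p \in U -> ~~ e x p -> I A -> A (val x) ->
  linearly_convex (@circle R) (angle (angle 0 (val p))) A.
Proof.
move=> xU pU x_p IA Ax; apply: (@circularly_convex_cut _ _ _ _ _ (val p)).
- exact: circle_arc_circularly_convex (I_arcs IA).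
- exact: in_circle.
- by move=> q; exact: angle_cut_min (in_circle p).
- move=> Ap; move/negP: x_p; apply; apply/bipartitioned_adjP.
  by split; [rewrite pU (negbTE xU) | exists A].
Qed.

Lemma dominating_pair_of_nonadjacent x y0 p :
  x \notin U -> p \in U -> ~~ e x p -> e x y0 ->
  exists y z, [/\ e x y, e x z & dominates_second_neighbours e x [set y; z]].
Proof.
move=> xU pU x_p xy0; set a := angle 0 (val p).
have [y xy y_min] := arg_minP (angle a \o val) xy0.
have [z xz z_max] := arg_maxP (angle a \o val) xy0.
exists y, z; split=> // v u xv vu.
have vU := bipartition_adj_out e_bip xv xU.
have uU := bipartition_adj_in e_bip vu vU.
have I_e w w' : e w w' -> in_common_member I (val w) (val w').
  by move=> /bipartitioned_adjP[].
have e_I w : e x w -> in_common_member I (val u) (val w) -> e u w.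
  move=> xw I_uw; apply/bipartitioned_adjP; split=> //.
  by rewrite (negbTE uU) (bipartition_adj_out e_bip xw xU).
have I_circ A (IA : I A) := circle_arc_circularly_convex a (I_arcs IA).
have Ix_lin A := @nonadjacent_linearly_convex x p A xU pU x_p.
have yvz : angle a (val y) <= angle a (val v) <= angle a (val z).
  by apply/andP; split; [exact: y_min | exact: z_max].
have [I_uy|I_uz] := in_common_member_extremes (in_circle y) (in_circle z)
  (in_circle u) I_circ Ix_lin (I_e _ _ xy) (I_e _ _ xz) yvz (I_e _ _ vu).
  by exists y; [rewrite set21 | exact: e_I].
by exists z; [rewrite set22 | exact: e_I].
Qed.

Lemma exists_dominating_pair : (exists x y, e x y) ->
  exists x y z, [/\ x \notin U, e x y, e x z &
                    dominates_second_neighbours e x [set y; z]].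
Proof.
move=> [x0 [y0 xy0]].
wlog x0U : x0 y0 xy0 / x0 \notin U.
  have [x0U wl|x0U wl] := boolP (x0 \in U); last exact: wl xy0 x0U.
  apply: (wl y0 x0); first by rewrite bipartitioned_adj_sym.
  exact: (bipartition_adj_in e_bip xy0 x0U).
have [[x [y [p [xU pU xp xy]]]]|complete] :=
    pselect (exists x y p, [/\ x \notin U, p \in U, ~~ e x p & e x y]).
  have [y' [z' [xy' xz' dom]]] := dominating_pair_of_nonadjacent xU pU xp xy.
  by exists x, y', z'.
exists x0, y0, y0; split=> // v u xv vu; exists y0; first by rewrite set21.
have vU := bipartition_adj_out e_bip xv x0U.
apply: contraT => uy0; case: complete; exists u, v, y0; split=> //.
- exact: (bipartition_adj_in e_bip vu vU).
- exact: (bipartition_adj_out e_bip xy0 x0U).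
- by rewrite bipartitioned_adj_sym.
Qed.

Lemma first_class_in_at_most_half : (exists x y, e x y) ->
  exists2 u, u \in U & in_at_most_half e u.
Proof.
move=> /exists_dominating_pair[x [y [z [xU xy xz yz_dom]]]].
have [y_half|z_half] := in_at_most_half_dominating_pair bipartitioned_adj_sym
  e_bip xU xy xz yz_dom.
  by exists y => //; exact: (bipartition_adj_out e_bip xy xU).
by exists z => //; exact: (bipartition_adj_out e_bip xz xU).
Qed.

End BipartitionedCircularIntervalGraphs.

Lemma bipartitioned_adjC (R : realType) (V : {fset R * R})
    (I : set (set (R * R))) (U W : {set V}) :
  bipartitioned_circular_interval_adj I U W =
  bipartitioned_circular_interval_adj I W U.
Proof.
by apply/funext => x; apply/funext => y; congr (_ && _); exact: andbC.
Qed.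

Theorem theorem11 (R : realType) (V : {fset R * R}) (I : set (set (R * R)))
    (U W : {set V})
    (V_circle : forall p : R * R, p \in V -> circle p)
    (I_arcs : forall A : set (R * R), I A -> circle_arc A)
    (UW_cover : (U :|: W = [set: V])%SET)
    (UW_disjoint : [disjoint U & W])
    (has_edge : exists x y : V, bipartitioned_circular_interval_adj I U W x y) :
  (exists2 u : V, u \in U &
     in_at_most_half (bipartitioned_circular_interval_adj I U W) u) /\
  (exists2 w : V, w \in W &
     in_at_most_half (bipartitioned_circular_interval_adj I U W) w).
Proof.
split; first exact: first_class_in_at_most_half.
rewrite bipartitioned_adjC; apply: first_class_in_at_most_half => //.
- by rewrite finset.setUC.
- by rewrite disjoint_sym.
- by rewrite bipartitioned_adjC.
Qed.
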